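(* Let $A$ be a Hermitian $n\times n$ matrix with pairwise distinct eigenvalues $\lambda_1,\dots,\lambda_n$ and corresponding normalized eigenvectors $\mathbf{v}_1,\dots,\mathbf{v}_n\in\mathbb{C}^n$, and let $\sigma(A)=\{\lambda_1,\dots,\lambda_n\}$. (1) Let $\boldsymbol{\varphi}=\sum_{j=1}^n a_j\mathbf{v}_j\in\mathbb{C}^n$ be a nonzero vector, and set $I_0:=\{j\mid a_j=0\}$ and $\sigma_0(A):=\{\lambda_j\mid j\in I_0\}$. Then for every natural number $k$, every set $S=\{z_1,\dots,z_k\}$ of $k$ pairwise distinct complex numbers satisfying $S\cap\sigma(A)=\sigma_0(A)$, and every sequence $m_1,\dots,m_k$ of natural numbers (positive integers) with $m_1+\dots+m_k=n$, there is a vector $\boldsymbol{\psi}\in\mathbb{C}^n$ such that the matrix $B=A+\boldsymbol{\psi}\boldsymbol{\varphi}^{*}$ has eigenvalues $z_1,\dots,z_k$ of algebraic multiplicities $m_1,\dots,m_k$ respectively. (2) The same holds with the roles of $\boldsymbol{\varphi}$ and $\boldsymbol{\psi}$ interchanged: let $\boldsymbol{\psi}=\sum_{j=1}^n b_j\mathbf{v}_j\in\mathbb{C}^n$ be a nonzero vector, and set $I_0:=\{j\mid b_j=0\}$ and $\sigma_0(A):=\{\lambda_j\mid j\in I_0\}$. Then for every natural number $k$, every set $S=\{z_1,\dots,z_k\}$ of $k$ pairwise distinct complex numbers with $S\cap\sigma(A)=\sigma_0(A)$, and every sequence $m_1,\dots,m_k$ of natural numbers with $m_1+\dots+m_k=n$,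 there is a vector $\boldsymbol{\varphi}\in\mathbb{C}^n$ such that $B=A+\boldsymbol{\psi}\boldsymbol{\varphi}^{*}$ has eigenvalues $z_1,\dots,z_k$ of algebraic multiplicities $m_1,\dots,m_k$ respectively.
   Context: Vectors of $\mathbb{C}^n$ are column vectors; $\langle\cdot,\cdot\rangle_{\mathbb{C}^n}$ is the standard inner product, linear in the first argument; $\boldsymbol{\varphi}^{*}$ is the conjugate transpose of $\boldsymbol{\varphi}$, so that $B\mathbf{x}=A\mathbf{x}+\langle\mathbf{x},\boldsymbol{\varphi}\rangle_{\mathbb{C}^n}\boldsymbol{\psi}$. *)

(* Defs.v *)
From mathcomp Require Import all_boot all_order all_algebra.
From mathcomp Require Import sesquilinear spectral.
From mathcomp Require Import complex.
From mathcomp Require Import boolp classical_sets reals.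

Set Implicit Arguments.
Unset Strict Implicit.
Unset Printing Implicit Defensive.

Import Order.TTheory GRing.Theory Num.Theory.
Local Open Scope ring_scope.
Local Open Scope sesquilinear_scope.

Section Defs.

Variable C : numClosedFieldType.

(* Linear in [x], conjugate-linear in [y]; the library's [dotmx] is the same
   form on row vectors. *)
Definition cinner (n : nat) (x y : 'cV[C]_n) : C := (y ^t* *m x) 0 0.

Definition cnorm (n : nat) (x : 'cV[C]_n) : C := sqrtC (cinner x x).

Definition alg_mult (n : nat) (B : 'M[C]_n) (c : C) : nat :=
  mup c (char_poly B).

(* The [z i] are all the eigenvalues of [B].  The library's [eigenvalue] is
   phrased with row eigenvectors; a square matrix has the same left and right
   eigenvalues. *)
Definition has_spectrum (n k : nat) (B : 'M[C]_n) (z : 'I_k -> C)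
    (m : 'I_k -> nat) : Prop :=
  (forall c : C, eigenvalue B c <-> exists i, c = z i) /\
  (forall i, alg_mult B (z i) = m i).

End Defs.

(* Main.v *)
Require Import Defs.
From mathcomp Require Import all_boot all_order all_algebra.
From mathcomp Require Import sesquilinear spectral.
From mathcomp Require Import complex.
From mathcomp Require Import boolp classical_sets reals.

Set Implicit Arguments.
Unset Strict Implicit.
Unset Printing Implicit Defensive.

Import Order.TTheory GRing.Theory Num.Theory.
Local Open Scope classical_set_scope.
Local Open Scope ring_scope.
Local Open Scope sesquilinear_scope.

(** In the orthonormal eigenbasis of [A] the problem becomes: perturb the
    diagonal matrix [D] of the [lambda j] by [p q^*], where [p] and [q] are the
    coordinates of [psi] and [phi].  By the matrix determinant lemma
    ([det_rank1_update], [char_poly_diag_rank1]) the characteristic polynomial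
    of [D + p q^*] is
      [\prod_j (X - lambda j)
        - \sum_j p j * (q j)^* * \prod_(i != j) (X - lambda i)],
    so its value at [lambda j] is
      [- p j * (q j)^* * \prod_(i != j) (lambda j - lambda i)].

    The polynomial aimed at is [T = \prod_i (X - z i) ^+ m i].  Both polynomials
    are monic of degree [n], hence they are equal as soon as they agree at the
    [n] distinct points [lambda j] ([monic_eq_at_nodes]).  This prescribes each
    product [p j * (q j)^*] separately: it must be [interp_weight lambda T j], a
    multiple of [T.[lambda j]].  When one factor is given, the other is found by
    dividing, which fails only where the given coordinate vanishes; but there
    [lambda j] belongs to [sigma_0(A)], hence is one of the [z i], so that
    [T.[lambda j] = 0] and the prescribed product is [0] too.  The two parts
    differ only in which factor is given. *)

(** * Characteristic polynomials of rank-one perturbations *)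

(** The matrix determinant lemma.  Right-multiplying the bordered matrix
    [[E, -p; q, 1]] by two block-triangular matrices clears either of its
    off-diagonal blocks; comparing determinants gives the identity up to the
    regular factor [\det E].  [F] plays the part of the adjugate of [E], and
    leaving it free lets diagonal matrices use an explicit one. *)
Lemma det_rank1_update (R : comPzRingType) (n : nat) (E F : 'M[R]_n)
    (p : 'cV[R]_n) (q : 'rV[R]_n) :
  GRing.lreg (\det E) -> E *m F = (\det E)%:M ->
  \det (E + p *m q) = \det E + (q *m F *m p) 0 0.
Proof.
move=> regE EF; pose M := block_mx E (- p) q (1%:M : 'M_1).
have detM : \det M = \det (E + p *m q).
  have : M *m block_mx 1%:M 0 (- q) 1%:M = block_mx (E + p *m q) (- p) 0 1%:M.
    rewrite mulmx_block !mulmx1 !mulmx0 mul1mx mulNmx mulmxN opprK.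
    by rewrite add0r subrr add0r.
  move/(congr1 determinant).
  by rewrite det_mulmx det_lblock det_ublock !det1 !mulr1.
have : M *m block_mx 1%:M (F *m p) 0 (\det E)%:M
    = block_mx E 0 q (q *m F *m p + (\det E)%:M).
  rewrite mulmx_block !mulmx1 !mulmx0 mul1mx !addr0 !mulmxA EF.
  by rewrite mulNmx mul_scalar_mx mul_mx_scalar subrr.
move/(congr1 determinant).
rewrite det_mulmx det_ublock det_lblock det1 mul1r !det_mx11 !mxE eqxx mulr1n.
by rewrite detM mulrC addrC => /regE.
Qed.

(** Apply the matrix determinant lemma to [X - D], whose determinant is monic
    and hence regular, with the diagonal matrix of the products that omit one
    factor as adjugate. *)
Lemma char_poly_diag_rank1 (R : comNzRingType) (n : nat) (l : 'I_n -> R)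
    (p : 'cV[R]_n) (q : 'rV[R]_n) :
  char_poly (diag_mx (\row_j l j) + p *m q)
  = \prod_j ('X - (l j)%:P)
    - \sum_j (p j 0 * q 0 j)%:P * \prod_(i < n | i != j) ('X - (l i)%:P).
Proof.
pose d : 'rV[{poly R}]_n := \row_j ('X - (l j)%:P).
pose F := diag_mx (\row_j \prod_(i < n | i != j) d 0 i).
have detE : \det (diag_mx d) = \prod_j ('X - (l j)%:P).
  by rewrite det_diag; apply: eq_bigr => j _; rewrite mxE.
have regE : GRing.lreg (\det (diag_mx d)).
  by rewrite detE; apply/monic_lreg/monic_prod => j _; apply: monicXsubC.
have EF : diag_mx d *m F = (\det (diag_mx d))%:M.
  rewrite mulmx_diag det_diag -diag_const_mx; congr diag_mx.
  by apply/rowP=> j; rewrite !mxE [RHS](bigD1 j)//= !mxE.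
have -> : char_poly (diag_mx (\row_j l j) + p *m q)
    = \det (diag_mx d + map_mx polyC (- p) *m map_mx polyC q).
  rewrite /char_poly /char_poly_mx map_mxD map_mxM map_mxN mulNmx opprD addrA.
  congr (\det (_ - _)); apply/matrixP => i j; rewrite !mxE.
  by case: eqP => _; rewrite ?mulr1n ?mulr0n ?subr0.
rewrite (det_rank1_update _ _ regE EF) detE; congr (_ + _).
rewrite mul_mx_diag mxE -sumrN; apply: eq_bigr => j _.
have -> : \prod_(i < n | i != j) ('X - (l i)%:P) = \prod_(i < n | i != j) d 0 i.
  by apply: eq_bigr => i _; rewrite mxE.
by rewrite !mxE polyCN mulrN polyCM mulrC mulrA.
Qed.

Lemma char_poly_conj (R : comNzRingType) (n : nat) (P Q M : 'M[R]_n) :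
  P *m Q = 1%:M -> char_poly (P *m M *m Q) = char_poly M.
Proof.
move=> PQ; have PQX : map_mx polyC P *m map_mx polyC Q = 1%:M.
  by rewrite -map_mxM PQ map_mx1.
have -> : char_poly (P *m M *m Q)
    = \det (map_mx polyC P *m char_poly_mx M *m map_mx polyC Q).
  rewrite /char_poly /char_poly_mx !map_mxM mulmxBr mulmxBl.
  by rewrite scalar_mxC -[(_%:M *m _) *m _]mulmxA PQX mulmx1.
by rewrite !det_mulmx mulrAC -det_mulmx PQX det1 mul1r.
Qed.

(** * Interpolation at the eigenvalues *)

(** The leading terms cancel in [f - g], which thus has more roots than its
    degree allows. *)
Lemma monic_eq_at_nodes (R : idomainType) (n : nat) (l : 'I_n -> R)
    (f g : {poly R}) :
  injective l -> f \is monic -> g \is monic ->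
  size f = n.+1 -> size g = n.+1 -> (forall j, f.[l j] = g.[l j]) -> f = g.
Proof.
move=> l_inj f1 g1 sf sg fg; apply/eqP; rewrite -subr_eq0; apply/eqP.
apply: (@roots_geq_poly_eq0 _ _ (codom l)).
- by apply/allP => _ /codomP[j ->]; rewrite rootE hornerD hornerN fg subrr.
- by rewrite map_inj_uniq ?enum_uniq.
rewrite size_codom card_ord; apply/leq_sizeP => i; rewrite leq_eqVlt coefB.
case/orP => [/eqP <-|lt_ni].
  move/monicP: f1; move/monicP: g1; rewrite /lead_coef sf sg /= => -> ->.
  by rewrite subrr.
by rewrite !nth_default ?subrr // ?sf ?sg.
Qed.

(** Minus the residue at [l j] of the rational function
    [T / \prod_i (X - l i)]. *)
Definition interp_weight (F : fieldType) (n : nat) (l : 'I_n -> F)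
    (T : {poly F}) (j : 'I_n) : F :=
  - T.[l j] / \prod_(i < n | i != j) (l j - l i).

(** At the node [l j] only the summand of index [j] of the characteristic
    polynomial survives, and the weight is chosen to make it [T.[l j]]. *)
Lemma char_poly_interp_weight (F : fieldType) (n : nat) (l : 'I_n -> F)
    (T : {poly F}) (p : 'cV[F]_n) (q : 'rV[F]_n) :
  injective l -> T \is monic -> size T = n.+1 ->
  (forall j, p j 0 * q 0 j = interp_weight l T j) ->
  char_poly (diag_mx (\row_j l j) + p *m q) = T.
Proof.
move=> l_inj T1 sT pq; apply: (monic_eq_at_nodes l_inj) => //.
- exact: char_poly_monic.
- exact: size_char_poly.
move=> j; have prod_j i : (\prod_(k < n | k != i) ('X - (l k)%:P)).[l j]
    = \prod_(k < n | k != i) (l j - l k).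
  by rewrite horner_prod; apply: eq_bigr => k _; rewrite !hornerE.
rewrite char_poly_diag_rank1 hornerD hornerN horner_prod (bigD1 j)//=.
rewrite hornerXsubC subrr mul0r sub0r horner_sum (bigD1 j)//=.
rewrite [X in _ + X]big1 => [|i i_j].
  rewrite hornerM hornerC prod_j addr0 pq /interp_weight !mulNr divfK ?opprK//.
  by apply/prodf_neq0 => i; rewrite subr_eq0 (inj_eq l_inj) eq_sym.
by rewrite hornerM prod_j (bigD1 j) 1?eq_sym//= subrr mul0r mulr0.
Qed.

(** * The polynomial with prescribed roots and multiplicities *)

Definition target_poly (F : fieldType) (k : nat) (z : 'I_k -> F)
    (m : 'I_k -> nat) : {poly F} :=
  \prod_i ('X - (z i)%:P) ^+ m i.

Section Target.

Variables (F : fieldType) (k : nat) (z : 'I_k -> F) (m : 'I_k -> nat).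

Lemma target_poly_monic : target_poly z m \is monic.
Proof. by apply: monic_prod => i _; apply/monic_exp/monicXsubC. Qed.

Lemma size_target_poly : size (target_poly z m) = (\sum_i m i).+1.
Proof.
rewrite size_prod => [|i _]; last by rewrite expf_neq0 ?polyXsubC_eq0.
rewrite (eq_bigr (fun i => m i + 1)%N) => [|i _]; last first.
  by rewrite size_exp_XsubC addn1.
by rewrite big_split /= sum1_card subSn ?leq_addl // addnK.
Qed.

Lemma root_target_poly c :
  (forall i, (0 < m i)%N) ->
  root (target_poly z m) c <-> exists i, c = z i.
Proof.
move=> m_gt0; rewrite rootE horner_prod prodf_seq_eq0; split.
  case/hasP => i _; rewrite horner_exp !hornerE expf_eq0 m_gt0 subr_eq0.
  by move/eqP => ->; exists i.
case=> i ->; apply/hasP; exists i; first by rewrite mem_index_enum.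
by rewrite horner_exp !hornerE subrr expr0n gtn_eqF.
Qed.

Lemma mup_target_poly i :
  injective z -> mup (z i) (target_poly z m) = m i.
Proof.
move=> z_inj; rewrite /target_poly (bigD1 i)//= mupMl ?mup_XsubCX ?eqxx//.
rewrite rootE horner_prod; apply/prodf_neq0 => j ji.
by rewrite horner_exp !hornerE expf_neq0 // subr_eq0 (inj_eq z_inj) eq_sym.
Qed.

End Target.

Lemma has_spectrum_target (C : numClosedFieldType) (n k : nat) (B : 'M[C]_n)
    (z : 'I_k -> C) (m : 'I_k -> nat) :
  injective z -> (forall i, (0 < m i)%N) ->
  char_poly B = target_poly z m -> has_spectrum B z m.
Proof.
move=> z_inj m_gt0 BT; split=> [c|i]; last first.
  by rewrite /alg_mult BT mup_target_poly.
by rewrite eigenvalue_root_char BT; apply: root_target_poly.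
Qed.

(** * Reduction to the diagonal case *)

Section Hermitian.

Variables (C : numClosedFieldType) (n : nat).

Lemma hermitian_adjoint (A : 'M[C]_n) (x y : 'cV[C]_n) :
  A \is hermsymmx -> cinner (A *m x) y = cinner x (A *m y).
Proof.
move/is_hermitianmxP; rewrite expr0 scale1r => A_adj.
by rewrite /cinner trmx_mul map_mxM -A_adj mulmxA.
Qed.

Lemma cinnerZl (c : C) (x y : 'cV[C]_n) : cinner (c *: x) y = c * cinner x y.
Proof. by rewrite /cinner -scalemxAr mxE. Qed.

Lemma cinnerZr (c : C) (x y : 'cV[C]_n) :
  cinner x (c *: y) = c^* * cinner x y.
Proof. by rewrite /cinner linearZ /= map_mxZ -scalemxAl mxE. Qed.

(** Moving [A] across the inner product gives
    [lambda j * <v j, v i> = (lambda i)^* * <v j, v i>].  The case [i = j] shows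
    that the eigenvalues are real, and then distinct ones force
    orthogonality. *)
Lemma hermitian_eigenvectors_orthonormal (A : 'M[C]_n) (lambda : 'I_n -> C)
    (v : 'I_n -> 'cV[C]_n) :
  A \is hermsymmx -> injective lambda ->
  (forall j, A *m v j = lambda j *: v j) -> (forall j, cnorm (v j) = 1) ->
  forall i j, cinner (v j) (v i) = (i == j)%:R.
Proof.
move=> A_herm l_inj v_eigen v1.
have vv j : cinner (v j) (v j) = 1.
  by rewrite -[LHS]sqrtCK -/(cnorm _) v1 expr1n.
have sym i j :
    lambda j * cinner (v j) (v i) = (lambda i)^* * cinner (v j) (v i).
  by rewrite -cinnerZl -cinnerZr -!v_eigen hermitian_adjoint.
have l_real i : (lambda i)^* = lambda i.
  by have := sym i i; rewrite vv !mulr1.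
move=> i j; have [->|ij] := eqVneq i j; first exact: vv.
have /eqP := sym i j; rewrite l_real -subr_eq0 -mulrBl mulf_eq0 subr_eq0.
by rewrite (inj_eq l_inj) eq_sym (negPf ij) => /eqP.
Qed.

(** Conjugation by the unitary matrix [V] with columns [v j], which sends the
    coordinate column [p] to [V *m p] and the row [q^*] to [(V *m q)^*]. *)
Lemma eigenbasis_rank1_update (A : 'M[C]_n) (lambda : 'I_n -> C)
    (v : 'I_n -> 'cV[C]_n) (p q : 'I_n -> C) :
  A \is hermsymmx -> injective lambda ->
  (forall j, A *m v j = lambda j *: v j) -> (forall j, cnorm (v j) = 1) ->
  char_poly (A + (\sum_j p j *: v j) *m (\sum_j q j *: v j)^t*)
  = char_poly (diag_mx (\row_j lambda j) + (\col_j p j) *m (\row_j (q j)^*)).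
Proof.
move=> A_herm l_inj v_eigen v1.
pose V : 'M[C]_n := \matrix_(i, j) v j i 0.
have V_comb (x : 'I_n -> C) : \sum_j x j *: v j = V *m \col_j x j.
  apply/colP => i; rewrite summxE mxE; apply: eq_bigr => j _.
  by rewrite !mxE mulrC.
have VV : V^t* *m V = 1%:M.
  apply/matrixP => i j; rewrite [RHS]mxE.
  rewrite -(hermitian_eigenvectors_orthonormal A_herm l_inj v_eigen v1).
  by rewrite /cinner !mxE; apply: eq_bigr => h _; rewrite !mxE.
have AV : A *m V = V *m diag_mx (\row_j lambda j).
  apply/matrixP => i j; rewrite mul_mx_diag mxE.
  have /colP/(_ i) := v_eigen j; rewrite !mxE mulrC => <-.
  by apply: eq_bigr => h _; rewrite !mxE.
have VV' : V *m V^t* = 1%:M by apply: mulmx1C.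
rewrite -[RHS](char_poly_conj _ VV'); congr char_poly.
rewrite mulmxDr mulmxDl -AV -[A *m V *m _]mulmxA VV' mulmx1 !V_comb.
rewrite trmx_mul map_mxM !mulmxA; congr (_ + _ *m _ *m _).
by apply/rowP => j; rewrite !mxE.
Qed.

Lemma has_spectrum_interp_weight (A : 'M[C]_n) (lambda : 'I_n -> C)
    (v : 'I_n -> 'cV[C]_n) (k : nat) (z : 'I_k -> C) (m : 'I_k -> nat)
    (p q : 'I_n -> C) :
  A \is hermsymmx -> injective lambda ->
  (forall j, A *m v j = lambda j *: v j) -> (forall j, cnorm (v j) = 1) ->
  injective z -> (forall i, (0 < m i)%N) -> (\sum_i m i)%N = n ->
  (forall j, p j * (q j)^* = interp_weight lambda (target_poly z m) j) ->
  has_spectrum (A + (\sum_j p j *: v j) *m (\sum_j q j *: v j)^t*) z m.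
Proof.
move=> A_herm l_inj v_eigen v1 z_inj m_gt0 sum_m pq.
apply: has_spectrum_target => //.
rewrite (eigenbasis_rank1_update _ _ A_herm l_inj v_eigen v1).
apply: char_poly_interp_weight => //; first exact: target_poly_monic.
  by rewrite size_target_poly sum_m.
by move=> j; rewrite !mxE pq.
Qed.

End Hermitian.

Theorem theorem5p2 (R : realType) (n : nat) (A : 'M[R[i]]_n)
    (lambda : 'I_n -> R[i]) (v : 'I_n -> 'cV[R[i]]_n)
    (A_herm : A \is hermsymmx)
    (lambda_inj : injective lambda)
    (v_eigen : forall j, A *m v j = lambda j *: v j)
    (v_normalized : forall j, cnorm (v j) = 1) :
  (forall (phi : 'cV[R[i]]_n) (a : 'I_n -> R[i]),
     phi = \sum_(j < n) a j *: v j -> phi != 0 ->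
     forall (k : nat) (z : 'I_k -> R[i]) (m : 'I_k -> nat),
       injective z ->
       range z `&` range lambda = [set lambda j | j in [set j | a j = 0]] ->
       (forall i, (0 < m i)%N) ->
       (\sum_(i < k) m i)%N = n ->
       exists psi : 'cV[R[i]]_n, has_spectrum (A + psi *m phi ^t*) z m)
  /\
  (forall (psi : 'cV[R[i]]_n) (b : 'I_n -> R[i]),
     psi = \sum_(j < n) b j *: v j -> psi != 0 ->
     forall (k : nat) (z : 'I_k -> R[i]) (m : 'I_k -> nat),
       injective z ->
       range z `&` range lambda = [set lambda j | j in [set j | b j = 0]] ->
       (forall i, (0 < m i)%N) ->
       (\sum_(i < k) m i)%N = n ->
       exists phi : 'cV[R[i]]_n, has_spectrum (A + psi *m phi ^t*) z m).
Proof.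
have weight0 (a : 'I_n -> R[i]) k (z : 'I_k -> R[i]) m :
    range z `&` range lambda = [set lambda j | j in [set j | a j = 0]] ->
    (forall i, (0 < m i)%N) ->
    forall j, a j = 0 -> interp_weight lambda (target_poly z m) j = 0.
  move=> zl m_gt0 j aj0.
  have [[i _ zi] _] : (range z `&` range lambda) (lambda j).
    by rewrite zl; exists j.
  have /rootP Tj : root (target_poly z m) (lambda j).
    by apply/root_target_poly => //; exists i.
  by rewrite /interp_weight Tj oppr0 mul0r.
have divKw (x w : R[i]) : (x = 0 -> w = 0) -> w / x * x = w.
  by have [->->//|x0 _] := eqVneq x 0; [rewrite mulr0 | rewrite divfK].
split=> [phi a ->|psi b ->] _ k z m z_inj zl m_gt0 sum_m.
- pose w := interp_weight lambda (target_poly z m).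
  pose p j := w j / (a j)^*; exists (\sum_j p j *: v j).
  apply: (@has_spectrum_interp_weight _ _ _ lambda) => // j.
  rewrite divKw // => /eqP.
  by rewrite conjC_eq0 => /eqP; apply: weight0 zl m_gt0 j.
- pose w := interp_weight lambda (target_poly z m).
  (* The coordinates of [phi] enter [B] conjugated. *)
  pose q j := (w j / b j)^*; exists (\sum_j q j *: v j).
  apply: (@has_spectrum_interp_weight _ _ _ lambda) => // j.
  rewrite conjCK mulrC divKw //.
  by apply: weight0 zl m_gt0 j.
Qed.
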